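(* Let $n\ge2$, $\boldsymbol{\pi}\in\Delta_n^\circ$, $\sigma>0$ and $\mathbf{x},\mathbf{y}\in\Delta_n^\circ$. Then $$H_{1+\sigma}\big(\mu_{\boldsymbol{\pi},\mathbf{y},\sigma}\,\big\|\,\mu_{\boldsymbol{\pi},\mathbf{x},\sigma}\big)=\frac1\sigma\,\Gamma_{\boldsymbol{\pi}}(\mathbf{y}\,\|\,\mathbf{x}).$$
   Context: $\Delta_n^\circ=\{\mathbf{x}\in(0,1]^n:\sum_ix_i=1\}$. For $\mathbf{x}\in(0,\infty)^n$, $\mathcal{C}[\mathbf{x}]=\mathbf{x}/\sum_jx_j$, $\mathbf{x}^{-1}=(1/x_i)_i$, $\odot$ is the componentwise product. For $\boldsymbol{\pi}\in\Delta_n^\circ$ and $\mathbf{x},\mathbf{y}\in(0,\infty)^n$, $\Gamma_{\boldsymbol{\pi}}(\mathbf{y}\,\|\,\mathbf{x})=\log\big(\sum_i\pi_i\frac{y_i}{x_i}\big)-\sum_i\pi_i\log\frac{y_i}{x_i}$. The scaled Dirichlet distribution $\mathcal{SD}(\boldsymbol{\alpha},\boldsymbol{\beta})$ ($\boldsymbol{\alpha},\boldsymbol{\beta}\in(0,\infty)^n$) is the law of $\mathcal{C}[\mathbf{X}]$ with $X_1,\dots,X_n$ independent, $X_i\sim\mathrm{Gamma}(\text{shape }\alpha_i,\text{ rate }\beta_i)$; and $\mu_{\boldsymbol{\pi},\mathbf{x},\sigma}=\mathcal{SD}\big(\tfrac1\sigma\boldsymbol{\pi},\ \boldsymbol{\pi}\odot\mathbf{x}^{-1}\big)$.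 For probability measures $\mu_1\ll\mu_2$ and $\alpha>0$, $\alpha\neq1$, the Rényi divergence is $H_\alpha(\mu_1\|\mu_2)=\frac{1}{\alpha-1}\log\int\big(\frac{d\mu_1}{d\mu_2}\big)^\alpha d\mu_2$ (and $+\infty$ if $\mu_1\not\ll\mu_2$). *)

(* Defs.v *)
From HB Require Import structures.
From mathcomp Require Import all_boot all_order all_algebra.
From mathcomp Require Import all_classical all_reals all_analysis.
From mathcomp Require Import measurable_realfun.

Set Implicit Arguments.
Unset Strict Implicit.
Unset Printing Implicit Defensive.

Import Order.TTheory GRing.Theory Num.Def Num.Theory.
Import numFieldNormedType.Exports.

Local Open Scope classical_set_scope.
Local Open Scope ring_scope.

Definition open_simplex (R : realType) (n : nat) (x : 'I_n -> R) : Prop :=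
  (forall i, 0 < x i <= 1) /\ \sum_(i < n) x i = 1.

Definition Gamma_div (R : realType) (n : nat) (pi y x : 'I_n -> R) : R :=
  ln (\sum_(i < n) pi i * (y i / x i)) - \sum_(i < n) pi i * ln (y i / x i).

Definition gamma_fun (R : realType) (a : R) : R :=
  fine (\int[@lebesgue_measure R]_(t in `]0%R, +oo[) (t `^ (a - 1) * expR (- t))%:E)%E.

Definition gamma_pdf (R : realType) (a b : R) (t : R) : R :=
  if 0 < t then b `^ a * t `^ (a - 1) * expR (- (b * t)) / gamma_fun a else 0.

Definition gamma_distributed d (T : measurableType d) (R : realType)
    (P : probability T R) (X : {RV P >-> R}) (a b : R) : Prop :=
  forall A : set R, measurable A ->
    distribution P X A = (\int[@lebesgue_measure R]_(t in A) (gamma_pdf a b t)%:E)%E.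

Definition mutually_independent d (T : measurableType d) (R : realType)
    (P : probability T R) (n : nat) (X : 'I_n -> {RV P >-> R}) : Prop :=
  forall A : 'I_n -> set R, (forall i, measurable (A i)) ->
    P (\bigcap_(i in [set: 'I_n]) (X i @^-1` A i)) =
    (\prod_(i < n) P (X i @^-1` A i))%E.

Lemma measurable_inv (R : realType) : measurable_fun [set: R] (@GRing.inv R).
Proof.
have -> : [set: R] = ~` [set 0] `|` [set 0] by rewrite setUC setUv.
apply/measurable_funU.
- by apply: measurableC.
- by [].
split; last exact: measurable_fun_set1.
apply: open_continuous_measurable_fun.
  by apply: closed_openC; apply: compact_closed; [exact: Rhausdorff | exact: compact_set1].
move=> x; rewrite inE /= => x0; apply: inv_continuous; exact/eqP.
Qed.

Section closure_rv.
Context d (T : measurableType d) (R : realType) (P : probability T R) (n : nat).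
Variable X : 'I_n -> {RV P >-> R}.

Definition closure_fun (w : T) : n.-tuple R :=
  [tuple X i w / \sum_(j < n) X j w | i < n].

Lemma measurable_closure_fun : measurable_fun [set: T] closure_fun.
Proof.
apply/measurable_fun_tnthP => i.
rewrite /closure_fun /comp.
under eq_fun => w do rewrite tnth_mktuple.
apply: measurable_funM => //.
apply: measurableT_comp; first exact: measurable_inv.
by apply: measurable_sum => j.
Qed.

HB.instance Definition _ :=
  isMeasurableFun.Build _ _ T (n.-tuple R) closure_fun measurable_closure_fun.

Definition closure_rv : {mfun T >-> n.-tuple R} := closure_fun.

End closure_rv.

Definition renyi_div d (T : measurableType d) (R : realType) (a : R)
    (mu1 mu2 : probability T R) : \bar R :=
  if pselect (mu1 `<< mu2) then
    match (\int[mu2]_x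
        ((fine (Radon_Nikodym (charge_of_finite_measure mu1) mu2 x)) `^ a)%:E)%E
    with
    | r%:E => ((a - 1)^-1 * ln r)%:E
    | +oo%E => if 1 < a then +oo%E else -oo%E
    | -oo%E => -oo%E
    end
  else +oo%E.

(* Main.v *)
Require Import Defs.
From HB Require Import structures.
From mathcomp Require Import all_boot all_order all_algebra.
From mathcomp Require Import all_classical all_reals all_analysis.
From mathcomp Require Import measurable_realfun ring lra.

Import Order.TTheory GRing.Theory Num.Def Num.Theory.
Import numFieldNormedType.Exports.
Local Open Scope classical_set_scope.
Local Open Scope ring_scope.

(** Write [p], [q] for the linear forms with coefficients the rates [b], [c] of
    [X], [Y], and [A] for the sum of the common shapes [a].  The law of [Y] has
    density [prod (c/b)^a * exp (p - q)] with respect to that of [X], and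
    [exp p] times the law of [X] is homogeneous of degree [A] under dilations.
    For [G] homogeneous of degree [-A], the integral of [G * phi(p) * exp p]
    against the law of [X] can therefore be averaged over dilations, which
    shows that it does not change when [p] is replaced by [q] in [phi].  With
    [phi r = r^A * exp (- r)] this gives the density
    [h = prod (c/b)^a * (p/q)^A] of the closure of [Y] with respect to the
    closure of [X], without polar coordinates.  When [A * sigma = 1], the
    integral of [h^(1 + sigma)] is the expectation of
    [h^sigma = (prod (c/b)^a)^sigma * (p/q)] at [Y], which is linear in the
    components [c i * Y i / q]; their means are [a i / A]. *)

(** * Image measures with a weight, and transfer of integrals between them *)

Section weighted_pushforward.
Local Open Scope ereal_scope.
Context {d d' : measure_display} {T : measurableType d} {T' : measurableType d'}
  {R : realType}.
Variables (mu : {measure set T -> \bar R}) (w : T -> R) (h : T -> T').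

(** The proofs are arguments so that the measure structure declared below can be inferred from the
    term [wpush w0 mw mh] itself. *)
Definition wpush (w0 : forall x, (0 <= w x)%R) (mw : measurable_fun [set: T] w)
  (mh : measurable_fun [set: T] h) (A : set T') : \bar R :=
  \int[mu]_(x in h @^-1` A) (w x)%:E.

Hypotheses (w0 : forall x, (0 <= w x)%R) (mw : measurable_fun [set: T] w)
  (mh : measurable_fun [set: T] h).

Let mpre {A} : measurable A -> measurable (h @^-1` A).
Proof. by move=> mA; rewrite -[X in measurable X]setTI; exact: mh. Qed.

Let wpush0 : wpush w0 mw mh set0 = 0.
Proof. by rewrite /wpush preimage_set0 integral_set0. Qed.

Let wpush_ge0 A : 0 <= wpush w0 mw mh A.
Proof. by apply: integral_ge0 => x _; rewrite lee_fin. Qed.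

Let wpush_sigma_additive : semi_sigma_additive (wpush w0 mw mh).
Proof.
move=> F mF tF mUF; rewrite /wpush preimage_bigcup; apply: cvg_toP.
  apply: ereal_nondecreasing_is_cvgn => m n mn.
  by apply: lee_sum_nneg_natr => // k _ _; apply: integral_ge0 => x _; rewrite lee_fin.
rewrite ge0_integral_bigcup//=.
- by move=> k; exact: mpre.
- exact/measurable_EFinP/measurable_funTS.
- by move=> x _; rewrite lee_fin.
- apply/trivIsetP => /= i j _ _ ij; rewrite -preimage_setI.
  by move/trivIsetP : tF => /(_ _ _ _ _ ij) ->//; rewrite preimage_set0.
Qed.

HB.instance Definition _ := isMeasure.Build _ _ _
  (wpush w0 mw mh) wpush0 wpush_ge0 wpush_sigma_additive.

Import HBNNSimple.

Let integral_wpush_indic r (E : set T') : (0 <= r)%R -> measurable E ->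
  \int[wpush w0 mw mh]_y (r * \1_E y)%:E =
  \int[mu]_x ((w x)%:E * (r * \1_E (h x))%:E).
Proof.
move=> r0 mE; under [LHS]eq_integral do rewrite EFinM.
rewrite ge0_integralZl//; last exact/measurable_EFinP/measurable_indic.
under [RHS]eq_integral do rewrite EFinM muleCA.
have mEh : measurable_fun [set: T] (fun x => (\1_E (h x) : R)%:E).
  by apply/measurable_EFinP/measurableT_comp => //; exact: measurable_indic.
rewrite [RHS]ge0_integralZl//; last 2 first.
- by apply: emeasurable_funM => //; exact/measurable_EFinP.
- by move=> x _; rewrite mule_ge0// lee_fin.
congr (_ * _); rewrite integral_indic// setIT /= /wpush integral_mkcond.
apply: eq_integral => x _; rewrite patchE indicE.
have -> : (x \in h @^-1` E) = (h x \in E) by apply/idP/idP; rewrite !inE.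
by case: (h x \in E); rewrite ?mule1// mule0.
Qed.

Let integral_wpush_nnsfun (f : {nnsfun T' >-> R}) :
  \int[wpush w0 mw mh]_y (f y)%:E = \int[mu]_x ((w x)%:E * (f (h x))%:E).
Proof.
have mfr r : measurable_fun [set: T']
  (fun y => (r * \1_(f @^-1` [set r]) y)%:E).
  exact/measurable_EFinP/measurable_funM.
under [LHS]eq_integral do rewrite fimfunE -fsumEFin//.
rewrite [LHS]ge0_integral_fsum//; last by move=> r y _; rewrite nnfun_muleindic_ge0.
under [RHS]eq_integral => x _.
  rewrite fimfunE -fsumEFin// ge0_mule_fsumr; last first.
    by move=> r; rewrite nnfun_muleindic_ge0.
  over.
rewrite [RHS]ge0_integral_fsum//; last 2 first.
- move=> r; apply: emeasurable_funM; first exact/measurable_EFinP.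
  exact: (measurableT_comp (mfr r)).
- by move=> r x _; rewrite mule_ge0// ?nnfun_muleindic_ge0 ?lee_fin.
apply: eq_fsbigr => r; rewrite inE/= => -[y _ fyr].
by rewrite integral_wpush_indic// -fyr.
Qed.

(** Change of variables, extended from indicators to simple functions and then, by monotone
    convergence along [nnsfun_approx], to nonnegative measurable functions. *)
Lemma integral_wpush (g : T' -> \bar R) :
  (forall y, 0 <= g y) -> measurable_fun [set: T'] g ->
  \int[wpush w0 mw mh]_y g y = \int[mu]_x ((w x)%:E * g (h x)).
Proof.
move=> g0 mg; pose g_ := nnsfun_approx measurableT mg.
have gcvg y : (g_ n y)%:E @[n --> \oo] --> g y by exact: cvg_nnsfun_approx.
have gnd y : nondecreasing_seq (fun n => (g_ n y)%:E).
  by move=> m n mn; rewrite lee_fin; exact/lefP/nd_nnsfun_approx.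
transitivity (limn (fun n => \int[wpush w0 mw mh]_y (g_ n y)%:E)).
  rewrite -monotone_convergence//=.
  - by apply: eq_integral => y _; apply/esym/cvg_lim.
  - by move=> n; exact/measurable_EFinP/measurable_funTS.
  - by move=> n y _; rewrite lee_fin.
under eq_fun do rewrite integral_wpush_nnsfun.
rewrite -monotone_convergence//=.
- apply: eq_integral => x _; apply/cvg_lim => //; exact: cvgeZl.
- move=> n; apply: emeasurable_funM; first exact/measurable_EFinP.
  by apply/measurable_EFinP/measurableT_comp.
- by move=> n x _; rewrite mule_ge0// lee_fin.
- by move=> x _ m n mn; rewrite lee_wpmul2l ?lee_fin//; exact: gnd.
Qed.

End weighted_pushforward.

(** The hypothesis on sets says that the two weighted image measures on [T'] coincide, so they
    integrate [g] alike. This is how identities checked on sets are upgraded to functions below. *)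
Lemma integral_transfer {d1 d2 d'} {T1 : measurableType d1}
    {T2 : measurableType d2} {T' : measurableType d'} {R : realType}
    (mu1 : {measure set T1 -> \bar R}) (mu2 : {measure set T2 -> \bar R})
    (w1 : T1 -> R) (w2 : T2 -> R) (h1 : T1 -> T') (h2 : T2 -> T')
    (g : T' -> \bar R) :
  (forall x, 0 <= w1 x) -> (forall x, 0 <= w2 x) ->
  measurable_fun [set: T1] w1 -> measurable_fun [set: T2] w2 ->
  measurable_fun [set: T1] h1 -> measurable_fun [set: T2] h2 ->
  (forall A, measurable A ->
    \int[mu1]_(x in h1 @^-1` A) (w1 x)%:E = \int[mu2]_(x in h2 @^-1` A) (w2 x)%:E)%E ->
  (forall y, 0 <= g y)%E -> measurable_fun [set: T'] g ->
  (\int[mu1]_x ((w1 x)%:E * g (h1 x)) = \int[mu2]_x ((w2 x)%:E * g (h2 x)))%E.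
Proof.
move=> w10 w20 mw1 mw2 mh1 mh2 h12 g0 mg.
rewrite -(integral_wpush mu1 _ _ w10 mw1 mh1)// -(integral_wpush mu2 _ _ w20 mw2 mh2)//.
by apply: eq_measure_integral => A mA _; exact: h12.
Qed.

(** The image of [k] times Lebesgue measure under [x |-> k * x + c] gives each half-open interval
    its length, hence is Lebesgue measure by uniqueness. *)
Lemma lebesgue_integral_affine {R : realType} (k c : R) (f : R -> \bar R) :
  0 < k -> (forall x, 0 <= f x)%E -> measurable_fun [set: R] f ->
  (\int[@lebesgue_measure R]_x (k%:E * f (k * x + c)%R) =
   \int[@lebesgue_measure R]_x f x)%E.
Proof.
move=> k0 f0 mf; have k0' : forall _ : measurableTypeR R, 0 <= k by move=> _; exact: ltW.
have mk : measurable_fun [set: measurableTypeR R] (fun=> k) by exact: measurable_cst.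
have mh : measurable_fun [set: measurableTypeR R]
    ((fun x => k * x + c) : measurableTypeR R -> measurableTypeR R).
  by apply: measurable_funD => //; apply: measurable_funM.
rewrite -(integral_wpush _ _ _ k0' mk mh)//.
apply: eq_measure_integral => A mA _; apply/esym/lebesgue_measure_unique => //.
move=> _ [[a b]] _ <-; rewrite /= /wpush integral_cst//=; last first.
  by rewrite -[X in measurable X]setTI; exact: mh.
have -> : (fun x : R => k * x + c) @^-1` `]a, b] =
  `](a - c) / k, (b - c) / k]%classic.
  apply/seteqP; split=> x /=; rewrite !in_itv/= ltr_pdivrMr// ler_pdivlMr//;
    by rewrite ltrBlDr lerBrDr mulrC.
rewrite !lebesgue_measure_itv/= !lte_fin ltr_pM2r ?invr_gt0// ltrD2r.
case: ifPn => _; last by rewrite mule0.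
rewrite -!EFinB -EFinM; congr EFin; field.
exact: lt0r_neq0.
Qed.

(** * Independence: expectations of products and densities of joint laws *)

Definition indep_funs {d : measure_display} {T : measurableType d} {R : realType}
    (P : probability T R) {n : nat} (X : 'I_n -> T -> R) : Prop :=
  forall A : 'I_n -> set R, (forall i, measurable (A i)) ->
    P (\bigcap_(i in [set: 'I_n]) (X i @^-1` A i)) =
    (\prod_(i < n) P (X i @^-1` A i))%E.

Lemma prodEFin_fine {R : realType} {n : nat} (e : 'I_n -> \bar R) :
  (forall i, e i \is a fin_num) ->
  (\prod_(i < n) e i)%E = (\prod_(i < n) fine (e i))%:E.
Proof.
move=> efin; rewrite (big_morph EFin (id1 := 1%E) (op1 := mule))//.
by apply: eq_bigr => i _; rewrite fineK.
Qed.

Lemma prod_indic {T : Type} {R : realType} {n : nat} (X : 'I_n -> T -> R)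
    (A : 'I_n -> set R) (x : T) :
  \prod_(i < n) \1_(A i) (X i x) =
  \1_(\bigcap_(i in [set: 'I_n]) (X i @^-1` A i)) x :> R.
Proof.
rewrite [RHS]indicE; have [xA|] := boolP (x \in _).
  rewrite big1// => i _; rewrite indicE mem_set//.
  by move: xA; rewrite inE => /(_ i); exact.
rewrite notin_setE => xA; apply/eqP/prodf_eq0; apply: contrapT => xA'.
apply: xA => i _ /=; apply: contrapT => xAi; apply: xA'; exists i => //.
by rewrite indicE memNset.
Qed.

Lemma expectation_prod {d : measure_display} {T : measurableType d}
    {R : realType} (P : probability T R) {n : nat} (X : 'I_n -> T -> R)
    (g : 'I_n -> R -> R) (e : 'I_n -> R) :
  (forall i, measurable_fun [set: T] (X i)) -> indep_funs P X ->
  (forall i t, 0 <= g i t) -> (forall i, measurable_fun [set: R] (g i)) ->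
  (forall i, \int[P]_x (g i (X i x))%:E = (e i)%:E)%E ->
  (\int[P]_x (\prod_(i < n) g i (X i x))%:E)%E = (\prod_(i < n) e i)%:E.
Proof.
move=> mX iX g0 mg ge.
(* The list [s] holds the coordinates at which [g] may be arbitrary; elsewhere [g i] is an
   indicator. Induction runs from the empty list to [enum 'I_n]. *)
suff H (s : seq 'I_n) : forall (g : 'I_n -> R -> R) (e : 'I_n -> R), (forall i t, 0 <= g i t) ->
    (forall i, measurable_fun [set: R] (g i)) ->
    (forall i, \int[P]_x (g i (X i x))%:E = (e i)%:E)%E ->
    (forall i, i \notin s -> exists2 A, measurable A & g i = \1_A) ->
    (\int[P]_x (\prod_(i < n) g i (X i x))%:E)%E = (\prod_(i < n) e i)%:E.
  by apply: (H (enum 'I_n)) => // i; rewrite mem_enum.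
elim: s => [|i s IH] {g e g0 mg ge} g e g0 mg ge gs.
  have /choice[A mA] : forall i, exists A, measurable A /\ g i = \1_A.
    by move=> i; have [//|A mA gA] := gs i; exists A.
  have mXA i : measurable (X i @^-1` A i).
    by rewrite -[X in measurable X]setTI; apply: mX => //; exact: (mA i).1.
  transitivity (\int[P]_x (\1_(\bigcap_(i in [set: 'I_n]) (X i @^-1` A i)) x)%:E)%E.
    apply: eq_integral => x _; congr EFin; rewrite indicE.
    rewrite -indicE -prod_indic; apply: eq_bigr => i _.
    by rewrite (mA i).2.
  rewrite integral_indic ?setIT//; last first.
    by apply: fin_bigcap_measurable => //; exact: finite_finset.
  transitivity (\prod_(i < n) P (X i @^-1` A i))%E.
    by apply: iX => j; exact: (mA j).1.
  rewrite prodEFin_fine//; last by move=> j; rewrite fin_num_measure.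
  congr EFin; apply: eq_bigr => j _; rewrite -[RHS]/(fine (e j)%:E) -(ge j).
  under eq_integral do rewrite (mA j).2.
  rewrite (_ : (fun x => _) = (fun x => (\1_(X j @^-1` A j) x)%:E))//.
  by rewrite integral_indic// setIT.
have [is_|is_] := boolP (i \in s).
  apply: IH => // j js; apply: gs; rewrite inE negb_or js andbT.
  by apply: contraNneq js => ->.
pose W x := \prod_(j < n | j != i) g j (X j x).
pose K := \prod_(j < n | j != i) e j.
have mgX j : measurable_fun [set: T] (fun x => g j (X j x)).
  exact: measurableT_comp.
have e0 j : 0 <= e j.
  by rewrite -lee_fin -(ge j); apply: integral_ge0 => x _; rewrite lee_fin.
have mW : measurable_fun [set: T] W.
  rewrite (_ : W = fun x => \prod_(j < n) if j != i then g j (X j x) else 1).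
    by apply: measurable_prod => j _; case: (j != i).
  by apply/funext => x; rewrite /W [LHS]big_mkcond.
have W0 x : 0 <= W x by apply: prodr_ge0.
have K0 : 0 <= K by apply: prodr_ge0.
transitivity (\int[P]_x ((W x)%:E * (g i (X i x))%:E))%E.
  by apply: eq_integral => x _; rewrite (bigD1 i)//= mulrC EFinM.
have mgi : measurable_fun [set: R] (fun t => (g i t)%:E).
  exact/measurable_EFinP.
rewrite (integral_transfer P P W (fun=> K) (X i) (X i) (fun t => (g i t)%:E))//; last 1 first.
  by move=> t; rewrite lee_fin.
  rewrite ge0_integralZl//; last 2 first.
  - exact/measurable_EFinP.
  - by move=> x _; rewrite lee_fin.
  by rewrite ge -EFinM (bigD1 i)//= mulrC.
move=> A mA; have mXA : measurable (X i @^-1` A).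
  by rewrite -[X in measurable X]setTI; exact: mX.
rewrite integral_cst//.
have Pfin : P (X i @^-1` A) \is a fin_num by rewrite fin_num_measure.
rewrite [X in (_ = _ * X)%E](_ : _ = (fine (P (X i @^-1` A)))%:E); last first.
  by rewrite fineK.
rewrite -EFinM.
pose g' j := if j == i then \1_A else g j.
pose e' j := if j == i then fine (P (X i @^-1` A)) else e j.
have <- : \prod_(j < n) e' j = K * fine (P (X i @^-1` A)).
  rewrite (bigD1 i)//= mulrC [in X in _ * X]/e' eqxx; congr (_ * _).
  by apply: eq_bigr => j /negbTE ji; rewrite /e' ji.
rewrite -(IH g').
- rewrite integral_mkcond; apply: eq_integral => x _; rewrite patchE.
  rewrite [in RHS](bigD1 i)//= [in X in _ = (X * _)%:E]/g' eqxx indicE.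
  rewrite (eq_bigr (fun j => g j (X j x))); last first.
    by move=> j /negbTE ji; rewrite /g' ji.
  have -> : (x \in X i @^-1` A) = (X i x \in A) by apply/idP/idP; rewrite !inE.
  by case: (X i x \in A); rewrite ?mul1r ?mul0r.
- by move=> j t; rewrite /g'; case: ifP.
- by move=> j; rewrite /g'; case: ifP => // _; exact: measurable_indic.
- move=> j; rewrite /g' /e'; case: eqVneq => [->|//].
  rewrite (_ : (fun x => _) = (fun x => (\1_(X i @^-1` A) x)%:E))//.
  by rewrite integral_indic// setIT fineK.
- move=> j js; rewrite /g'; case: eqVneq => [ji|ji]; first by exists A.
  by apply: gs; rewrite inE negb_or ji.
Qed.

Definition vec {T R : Type} {n : nat} (X : 'I_n -> T -> R) (w : T) : n.-tuple R :=
  [tuple X i w | i < n].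

Lemma measurable_vec {d : measure_display} {T : measurableType d} {R : realType}
    {n : nat} (X : 'I_n -> T -> R) :
  (forall i, measurable_fun [set: T] (X i)) -> measurable_fun [set: T] (vec X).
Proof.
move=> mX; apply/measurable_fun_tnthP => i.
rewrite (_ : _ \o _ = X i)//.
by apply/funext => x; rewrite /= tnth_mktuple.
Qed.

(** If each [Y i] has density [g i] with respect to the law of [X i], independence makes the product
    of the [g i] a density between the joint laws. Equality of measures is checked on rectangles,
    where both sides factor. *)
Lemma change_of_law_vec {d d' : measure_display} {T : measurableType d}
    {T' : measurableType d'} {R : realType} (P : probability T R)
    (Q : probability T' R) {n : nat} (X : 'I_n -> T -> R) (Y : 'I_n -> T' -> R)
    (g : 'I_n -> R -> R) (F : n.-tuple R -> \bar R) :
  (forall i, measurable_fun [set: T] (X i)) ->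
  (forall i, measurable_fun [set: T'] (Y i)) ->
  indep_funs P X -> indep_funs Q Y ->
  (forall i t, 0 <= g i t) -> (forall i, measurable_fun [set: R] (g i)) ->
  (forall i A, measurable A ->
    Q (Y i @^-1` A) = \int[P]_x (\1_A (X i x) * g i (X i x))%:E)%E ->
  (forall t, 0 <= F t)%E -> measurable_fun [set: n.-tuple R] F ->
  (\int[Q]_y F (vec Y y) =
   \int[P]_x ((\prod_(i < n) g i (X i x))%:E * F (vec X x)))%E.
Proof.
move=> mX mY iX iY g0 mg gYX F0 mF.
have mW : measurable_fun [set: T] (fun x => \prod_(i < n) g i (X i x)).
  by apply: measurable_prod => j _; exact: measurableT_comp.
have W0 (x : T) : 0 <= \prod_(i < n) g i (X i x) by apply: prodr_ge0.
have u0 (_ : T') : 0 <= 1 :> R by [].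
have mu : measurable_fun [set: T'] (fun=> 1 : R) by exact: measurable_cst.
transitivity (\int[Q]_y (1%:E * F (vec Y y)))%E.
  by apply: eq_integral => y _; rewrite mul1e.
have mvX := measurable_vec X mX; have mvY := measurable_vec Y mY.
apply: (integral_transfer Q P (fun=> 1) _ (vec Y) (vec X)) => // A mA.
rewrite -[LHS]/(wpush Q _ _ u0 mu mvY A) -[RHS]/(wpush P _ _ W0 mW mvX A).
(* Measurable rectangles: stable under intersection and generating the product sigma-algebra. *)
pose G : set (set (n.-tuple R)) := [set B | exists2 A : 'I_n -> set R,
  (forall i, measurable (A i)) & B = [set t | forall i, A i (tnth t i)]].
have rectX (B : 'I_n -> set R) S (Z : 'I_n -> S -> R) :
    vec Z @^-1` [set t | forall i, B i (tnth t i)] =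
    \bigcap_(i in [set: 'I_n]) (Z i @^-1` B i).
  apply/seteqP; split=> x /=.
    by move=> xB i _; have := xB i; rewrite tnth_mktuple.
  by move=> xB i; rewrite tnth_mktuple; exact: xB.
apply: (measure_unique G (fun=> setT)) => //.
- apply/seteqP; split.
    apply: smallest_sub; first exact: smallest_sigma_algebra.
    move=> B; rewrite -bigcup_seq => -[i _ [C mC <-]]; apply: sub_sigma_algebra.
    exists (fun j => if j == i then C else setT).
      by move=> j; case: ifP.
    apply/seteqP; split=> [t [_ Ct] j /=|t /= /(_ i)].
      by case: eqVneq => [->|].
    by rewrite eqxx; split.
  apply: smallest_sub; first exact: sigma_algebra_measurable.
  move=> _ [B mB ->]; rewrite (_ : [set t | _] =
      \bigcap_(i in [set: 'I_n]) ((@tnth n R ^~ i) @^-1` B i)); last first.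
    by apply/seteqP; split=> [t tB i _|t tB i]; exact: tB.
  apply: fin_bigcap_measurable => [|i _]; first exact: finite_finset.
  by rewrite -[X in measurable X]setTI; exact: measurable_tnth.
- move=> _ _ [B mB ->] [C mC ->]; exists (fun i => B i `&` C i).
    by move=> i; exact: measurableI.
  apply/seteqP; split=> t /=; first by move=> [Bt Ct] i; split.
  by move=> BC; split=> i; case: (BC i).
- move=> _; exists (fun=> setT) => //.
  by apply/seteqP; split.
- by rewrite bigcup_const//; exists 0%N.
- move=> _ [B mB ->]; rewrite /= /wpush !rectX.
  have mZB d0 (S : measurableType d0) (Z : 'I_n -> S -> R) :
      (forall i, measurable_fun [set: S] (Z i)) ->
      measurable (\bigcap_(i in [set: 'I_n]) (Z i @^-1` B i)).
    move=> mZ; apply: fin_bigcap_measurable => [|i _]; first exact: finite_finset.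
    by rewrite -[X in measurable X]setTI; exact: mZ.
  rewrite integral_cst ?mul1e; last exact: mZB.
  transitivity (\prod_(i < n) Q (Y i @^-1` B i))%E; first exact: iY.
  rewrite prodEFin_fine; last first.
    move=> i; rewrite fin_num_measure// -[X in measurable X]setTI.
    exact: mY.
  rewrite -(expectation_prod P X (fun i t => \1_(B i) t * g i t))//; last 3 first.
  + by move=> i t; rewrite mulr_ge0.
  + by move=> i; apply: measurable_funM.
  + move=> i; rewrite fineK; first exact/esym/gYX.
    by rewrite fin_num_measure// -[X in measurable X]setTI; exact: mY.
  rewrite [RHS]integral_mkcond; apply: eq_integral => x _; rewrite patchE.
  rewrite big_split/= prod_indic indicE.
  by case: (x \in _); rewrite ?mul1r ?mul0r.
- by move=> _; rewrite /= /wpush preimage_setT integral_cst// mul1e -ge0_fin_numE// fin_num_measure.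
Qed.

(** * Gamma densities and vectors of independent gamma variables *)

Lemma gamma_fun_ge0 {R : realType} (a : R) : 0 <= gamma_fun a.
Proof.
apply: fine_ge0; apply: integral_ge0 => t _.
by rewrite lee_fin mulr_ge0 ?powR_ge0 ?expR_ge0.
Qed.

Lemma gamma_pdf_ge0 {R : realType} (a b t : R) : 0 <= gamma_pdf a b t.
Proof.
rewrite /gamma_pdf; case: ifP => // _.
by rewrite divr_ge0 ?gamma_fun_ge0// !mulr_ge0 ?powR_ge0 ?expR_ge0.
Qed.

Lemma measurable_gamma_pdf {R : realType} (a b : R) :
  measurable_fun [set: R] (gamma_pdf a b).
Proof.
apply: measurable_fun_ifT => //.
  exact: measurable_fun_ltr.
apply: measurable_funM => //; apply: measurable_funM.
  by apply: measurable_funM => //; exact: measurable_powR.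
apply: measurableT_comp; first exact: measurable_expR.
by apply: measurableT_comp => //; exact: measurable_funM.
Qed.

(** The constant [gamma_fun a] depends on the shape only, so a change of rate costs a power and an
    exponential. *)
Lemma gamma_pdf_rate {R : realType} (a b c t : R) : 0 < b -> 0 < c ->
  gamma_pdf a c t =
  (c / b) `^ a * expR (- ((c - b) * t)) * gamma_pdf a b t.
Proof.
move=> b0 c0; rewrite /gamma_pdf; case: ifP => _; last by rewrite mulr0.
have -> : c `^ a = (c / b) `^ a * b `^ a.
  by rewrite -powRM ?divr_ge0 ?ltW// divfK// gt_eqF.
have -> : expR (- (c * t)) = expR (- ((c - b) * t)) * expR (- (b * t)).
  by rewrite -expRD; congr expR; ring.
ring.
Qed.

Lemma gamma_pdf_scale {R : realType} (a b k t : R) : 0 < b -> 0 < k ->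
  gamma_pdf a b t = k * gamma_pdf a (b / k) (k * t).
Proof.
move=> b0 k0; rewrite /gamma_pdf pmulr_rgt0//.
case: ifP => t0; last by rewrite mulr0.
rewrite (powRM _ (ltW k0) (ltW t0)).
have -> : b / k * (k * t) = b * t by field; rewrite gt_eqF.
have -> : b `^ a = (b / k) `^ a * (k * k `^ (a - 1)).
  have -> : k * k `^ (a - 1) = k `^ a.
    rewrite -[X in X * _](powRr1 (ltW k0)) -powRD; last by rewrite lt0r_neq0 ?implybT.
    by congr (_ `^ _); ring.
  by rewrite -powRM ?divr_ge0 ?ltW// divfK// gt_eqF.
ring.
Qed.

(** The components are bare functions, so that rescaled families such as [fun i x => k i * X i x]
    fit without building a new random variable. *)
Record gamma_vector {d : measure_display} {T : measurableType d} {R : realType}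
    (P : probability T R) {n : nat} (X : 'I_n -> T -> R) (a b : 'I_n -> R) :
    Prop := {
  gamma_vector_measurable : forall i, measurable_fun [set: T] (X i) ;
  gamma_vector_indep : indep_funs P X ;
  gamma_vector_law : forall i A, measurable A -> P (X i @^-1` A) =
    (\int[@lebesgue_measure R]_(t in A) (gamma_pdf (a i) (b i) t)%:E)%E }.

(** The shapes agree, so [gamma_pdf_rate] gives each one-dimensional density and [change_of_law_vec]
    multiplies them. *)
Lemma gamma_vector_change_of_rate {d d' : measure_display}
    {T : measurableType d} {T' : measurableType d'} {R : realType}
    (P : probability T R) (Q : probability T' R) {n : nat} (X : 'I_n -> T -> R)
    (Y : 'I_n -> T' -> R) (a b c : 'I_n -> R) (F : n.-tuple R -> \bar R) :
  (forall i, 0 < b i) -> (forall i, 0 < c i) ->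
  gamma_vector P X a b -> gamma_vector Q Y a c ->
  (forall t, 0 <= F t)%E -> measurable_fun [set: n.-tuple R] F ->
  (\int[Q]_y F (vec Y y) =
   \int[P]_x (((\prod_(i < n) (c i / b i) `^ a i) *
     expR (- \sum_(i < n) (c i - b i) * X i x))%:E * F (vec X x)))%E.
Proof.
move=> b0 c0 [mX iX lX] [mY iY lY] F0 mF.
pose g i t := (c i / b i) `^ a i * expR (- ((c i - b i) * t)).
have g0 i t : 0 <= g i t by rewrite mulr_ge0 ?powR_ge0 ?expR_ge0.
have mg i : measurable_fun [set: R] (g i).
  apply: measurable_funM => //.
  apply: measurableT_comp; first exact: measurable_expR.
  by apply: measurableT_comp => //; exact: measurable_funM.
rewrite (change_of_law_vec P Q X Y g)//; last first.
  move=> i A mA; rewrite lY//.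
  have m1 : measurable_fun [set: R] (fun t => (\1_A t * g i t)%:E).
    by apply/measurable_EFinP; exact: measurable_funM.
  transitivity (\int[P]_x (1%:E * (\1_A (X i x) * g i (X i x))%:E))%E; last first.
    by apply: eq_integral => x _; rewrite mul1e.
  (* The law of [X i] is the image of Lebesgue measure weighted by its gamma density, which brings
     the claim back to a pointwise identity on the line. *)
  rewrite -(integral_transfer (@lebesgue_measure R) P (gamma_pdf (a i) (b i))
    (fun=> 1) id (X i) (fun t => (\1_A t * g i t)%:E))//.
  - rewrite [LHS]integral_mkcond; apply: eq_integral => t _.
    rewrite patchE indicE -EFinM; case: (t \in A); last by rewrite mul0r mulr0.
    by rewrite (@gamma_pdf_rate _ _ (b i))// mul1r mulrC.
  - by move=> t; exact: gamma_pdf_ge0.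
  - exact: measurable_gamma_pdf.
  - exact: mX.
  - by move=> B mB; rewrite -lX// integral_cst ?mul1e// -[X in measurable X]setTI;
      exact: mX.
  - by move=> t; rewrite lee_fin mulr_ge0.
apply: eq_integral => x _; congr (_%:E * _)%E.
by rewrite big_split/= -expR_sum; congr (_ * expR _); rewrite sumrN.
Qed.

Lemma gamma_vector_scale {d : measure_display} {T : measurableType d}
    {R : realType} (P : probability T R) {n : nat} (X : 'I_n -> T -> R)
    (a b k : 'I_n -> R) :
  (forall i, 0 < b i) -> (forall i, 0 < k i) -> gamma_vector P X a b ->
  gamma_vector P (fun i x => k i * X i x) a (fun i => b i / k i).
Proof.
move=> b0 k0 [mX iX lX].
have mk i A : measurable A -> measurable ((fun t => k i * t) @^-1` A).
  move=> mA; rewrite -[X in measurable X]setTI.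
  by apply: (measurable_funM _ _) => //.
split.
- by move=> i; exact: measurable_funM.
- move=> A mA; have := iX (fun i => (fun t => k i * t) @^-1` A i).
  by apply=> i; exact: mk.
- move=> i A mA; have := lX i _ (mk i A mA).
  rewrite -[X in P X]/((fun x => k i * X i x) @^-1` A) => ->.
  rewrite [LHS]integral_mkcond [RHS]integral_mkcond.
  rewrite -[RHS](@lebesgue_integral_affine _ (k i) 0)//.
  + apply: eq_integral => t _; rewrite !patchE addr0.
    have -> : (t \in (fun t => k i * t) @^-1` A) = (k i * t \in A).
      by apply/idP/idP; rewrite !inE.
    case: ifP => _; last by rewrite mule0.
    by rewrite -EFinM -gamma_pdf_scale.
  + by move=> t; apply: erestrict_ge0 => u _; rewrite lee_fin gamma_pdf_ge0.
  + apply/(measurable_restrictT _ mA)/measurable_EFinP/measurable_funTS.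
    exact: measurable_gamma_pdf.
Qed.

(** The density vanishes off the positive half-line, so each component is positive with probability
    1. Later, quotients and powers are simplified on this event only, away from the default values
    of division and [powR]. *)
Lemma gamma_vector_gt0 {d : measure_display} {T : measurableType d}
    {R : realType} (P : probability T R) {n : nat} (X : 'I_n -> T -> R)
    (a b : 'I_n -> R) : gamma_vector P X a b ->
  {ae P, forall x, forall i, 0 < X i x}.
Proof.
move=> [mX iX lX].
pose O : set R := `]0, +oo[%classic.
have mO : measurable O by exact: measurable_itv.
pose S := \bigcap_(i in [set: 'I_n]) (X i @^-1` O).
have mXi i A : measurable A -> measurable (X i @^-1` A).
  by move=> mA; rewrite -[X in measurable X]setTI; exact: mX.
have mS : measurable S.
  by apply: fin_bigcap_measurable => [|i _]; [exact: finite_finset|exact: mXi].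
have PS : P S = 1%E.
  transitivity (\prod_(i < n) P (X i @^-1` O))%E; first exact: iX.
  rewrite big1// => i _; rewrite -(probability_setT P).
  rewrite -[in RHS](preimage_setT (X i)) [LHS]lX// [RHS]lX//.
  rewrite integral_mkcond; apply: eq_integral => t _; rewrite patchE.
  case: ifPn => //; rewrite notin_setE /O /= in_itv/= andbT => /negP/negbTE t0.
  by rewrite /gamma_pdf t0.
exists (~` S); split; first exact: measurableC.
  by rewrite probability_setC// PS subee.
move=> x /=; apply: contra_not => Sx i.
by have := Sx i I; rewrite /O /= in_itv/= andbT.
Qed.

(** * Dilations, and homogeneity of the exponentially weighted law *)

Definition tscale {R : realType} {n : nat} (k : R) (t : n.-tuple R) : n.-tuple R :=
  [tuple k * tnth t i | i < n].

Definition tdot {R : realType} {n : nat} (b : 'I_n -> R) (t : n.-tuple R) : R :=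
  \sum_(i < n) b i * tnth t i.

Lemma tdot_vec {T : Type} {R : realType} {n : nat} (b : 'I_n -> R)
    (X : 'I_n -> T -> R) (x : T) : tdot b (vec X x) = \sum_(i < n) b i * X i x.
Proof. by apply: eq_bigr => i _; rewrite tnth_mktuple. Qed.

Lemma tdot_scale {R : realType} {n : nat} (b : 'I_n -> R) (k : R) (t : n.-tuple R) :
  tdot b (tscale k t) = k * tdot b t.
Proof.
by rewrite mulr_sumr; apply: eq_bigr => i _; rewrite tnth_mktuple mulrCA.
Qed.

Lemma measurable_tdot {R : realType} {n : nat} (b : 'I_n -> R) :
  measurable_fun [set: n.-tuple R] (tdot b).
Proof.
apply: measurable_sum => i; apply: measurable_funM => //.
exact: measurable_tnth.
Qed.

(** The dilated vector has rates [b i / k]. Passing from it back to [X] produces the power of [k]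
    and an exponential that restores the weight [expR (tdot b _)]. *)
Lemma gamma_vector_weight_scale {d : measure_display} {T : measurableType d}
    {R : realType} (P : probability T R) {n : nat} (X : 'I_n -> T -> R)
    (a b : 'I_n -> R) (k : R) (F : n.-tuple R -> R) :
  (forall i, 0 < b i) -> gamma_vector P X a b -> 0 < k ->
  (forall t, 0 <= F t) -> measurable_fun [set: n.-tuple R] F ->
  (\int[P]_x (F (tscale k (vec X x)) * expR (tdot b (vec X x)))%:E =
   (k `^ (- \sum_(i < n) a i))%:E *
   \int[P]_x (F (vec X x) * expR (tdot b (vec X x)))%:E)%E.
Proof.
move=> b0 GX k0 F0 mF.
have [mX _ _] := GX.
have GkX := gamma_vector_scale P X a b (fun=> k) b0 (fun=> k0) GX.
(* Division by [k] undoes the dilation in the exponent: at [k X] the weight is that of [X]. *)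
pose F' t := (F t * expR (tdot b t / k))%:E.
pose kX i x := k * X i x.
have mE (h : n.-tuple R -> R) : measurable_fun [set: n.-tuple R] h ->
    measurable_fun [set: n.-tuple R] (fun t => (F t * expR (h t))%:E).
  move=> mh; apply/measurable_EFinP/measurable_funM => //.
  by apply: measurableT_comp; first exact: measurable_expR.
have mtb := measurable_tdot b.
transitivity (\int[P]_x F' (vec kX x))%E.
  apply: eq_integral => x _; rewrite /F'.
  have -> : vec kX x = tscale k (vec X x).
    by apply: eq_from_tnth => i; rewrite !tnth_mktuple.
  by rewrite tdot_scale mulrAC divff ?gt_eqF// mul1r.
rewrite (gamma_vector_change_of_rate P P X kX a b
  (fun i => b i / k))//; last 3 first.
- by move=> i; rewrite divr_gt0.
- by move=> t; rewrite lee_fin mulr_ge0 ?expR_ge0.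
- by apply: mE; exact: measurable_funM.
rewrite -ge0_integralZl//; last 3 first.
- exact: (measurableT_comp (mE _ mtb) (measurable_vec X mX)).
- by move=> x _; rewrite lee_fin mulr_ge0 ?expR_ge0.
- by rewrite lee_fin powR_ge0.
apply: eq_integral => x _; rewrite /F' -!EFinM; congr EFin.
have -> : \prod_(i < n) (b i / k / b i) `^ a i = k `^ (- \sum_(i < n) a i).
  rewrite -sumrN /powR gt_eqF// mulr_suml expR_sum.
  apply: eq_bigr => i _.
  have -> : b i / k / b i = k^-1 by field; rewrite !gt_eqF.
  by rewrite invr_eq0 gt_eqF// lnV// mulrN mulNr.
rewrite -mulrA; congr (_ * _); rewrite mulrCA -expRD; congr (_ * expR _).
rewrite !tdot_vec mulr_suml -sumrN -big_split/=; apply: eq_bigr => i _.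
by field; rewrite gt_eqF.
Qed.

(* Inserting [1 = \int \1_[0, 1[ (s + ln v) ds] and rescaling the argument by
   [expR (- s)] moves the dependence on [u] into the constant last factor. *)
Lemma gamma_vector_radial_average {d : measure_display} {T : measurableType d}
    {R : realType} (P : probability T R) {n : nat} (X : 'I_n -> T -> R)
    (a b : 'I_n -> R) (G u v : n.-tuple R -> R) (phi : R -> R) :
  (forall i, 0 < b i) -> gamma_vector P X a b ->
  (forall t, 0 <= G t) -> (forall r, 0 <= phi r) ->
  measurable_fun [set: n.-tuple R] G -> measurable_fun [set: R] phi ->
  measurable_fun [set: n.-tuple R] u -> measurable_fun [set: n.-tuple R] v ->
  (forall k t, 0 < k -> G (tscale k t) = k `^ (- \sum_(i < n) a i) * G t) ->
  (forall k t, 0 < k -> u (tscale k t) = k * u t) ->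
  (forall k t, 0 < k -> v (tscale k t) = k * v t) ->
  (forall t, G t != 0 -> 0 < u t) -> (forall t, G t != 0 -> 0 < v t) ->
  (\int[P]_x (G (vec X x) * phi (u (vec X x)) * expR (tdot b (vec X x)))%:E =
   \int[P]_x (G (vec X x) * \1_`[0%R, 1%R[ (ln (v (vec X x))) *
              expR (tdot b (vec X x)))%:E *
   \int[@lebesgue_measure R]_s (phi (expR (- s)))%:E)%E.
Proof.
move=> b0 GX G0 phi0 mG mphi mu mv Gk uk vk Gu Gv.
have [mX _ _] := GX; have mV := measurable_vec X mX.
set A := \sum_(i < n) a i in Gk *.
pose leb := @lebesgue_measure R.
pose psi : R -> R := \1_`[0%R, 1%R[.
have mpsi : measurable_fun [set: R] psi by apply: measurable_indic.
have psi0 r : 0 <= psi r by [].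
have mexp := @measurable_expR R.
have mln := @measurable_ln R.
have mE : measurable_fun [set: n.-tuple R] (fun t => expR (tdot b t)).
  exact: (measurableT_comp mexp (measurable_tdot b)).
have mGE : measurable_fun [set: n.-tuple R] (fun t => G t * expR (tdot b t)).
  exact: measurable_funM.
(* [f1] is the integrand with the extra variable [s] inserted, [f2] the one obtained by dilating
   [f1]. The order of integration is exchanged to apply the dilation at fixed [s], then exchanged
   back. *)
pose f1 (z : T * measurableTypeR R) : \bar R :=
  (G (vec X z.1) * expR (tdot b (vec X z.1)) * phi (u (vec X z.1)) *
   psi (z.2 + ln (v (vec X z.1))))%:E.
pose f2 (z : T * measurableTypeR R) : \bar R :=
  (G (vec X z.1) * expR (tdot b (vec X z.1)) * psi (ln (v (vec X z.1))) *
   phi (expR (- z.2) * u (vec X z.1)))%:E.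
have mV1 : measurable_fun [set: T * measurableTypeR R] (fun z => vec X z.1).
  exact: measurableT_comp.
have mlnv : measurable_fun [set: n.-tuple R] (fun t => ln (v t)).
  exact: (measurableT_comp mln mv).
have f10 z : (0 <= f1 z)%E.
  by rewrite lee_fin !mulr_ge0 ?expR_ge0.
have f20 z : (0 <= f2 z)%E.
  by rewrite lee_fin !mulr_ge0 ?expR_ge0.
have m2 : measurable_fun [set: T * measurableTypeR R] (fun z => z.2 : R).
  exact: measurable_snd.
have mf1 : measurable_fun [set: T * measurableTypeR R] f1.
  apply/measurable_EFinP; apply: measurable_funM; first apply: measurable_funM.
  - exact: (measurableT_comp mGE mV1).
  - exact: (measurableT_comp mphi (measurableT_comp mu mV1)).
  - apply: (measurableT_comp mpsi); apply: measurable_funD => //.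
    exact: (measurableT_comp mlnv mV1).
have mf2 : measurable_fun [set: T * measurableTypeR R] f2.
  apply/measurable_EFinP; apply: measurable_funM; first apply: measurable_funM.
  - exact: (measurableT_comp mGE mV1).
  - exact: (measurableT_comp mpsi (measurableT_comp mlnv mV1)).
  - apply: (measurableT_comp mphi); apply: measurable_funM => //.
      by apply: (measurableT_comp mexp); exact: measurableT_comp.
    exact: (measurableT_comp mu mV1).
have psi1 c : (\int[leb]_s (psi (s + c))%:E = 1)%E.
  transitivity (\int[leb]_s (psi s)%:E)%E; last first.
    rewrite integral_indic// setIT /= lebesgue_measure_itv/= lte_fin ltr01.
    by rewrite oppr0 adde0.
  rewrite -(@lebesgue_integral_affine R 1 c (fun s => (psi s)%:E))//.
  - by apply: eq_integral => s _; rewrite mul1e mul1r.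
  - exact/measurable_EFinP.
(* Translating [s] by [ln r] absorbs [r]; with [r] the value of [u], this removes [u] from the
   result. *)
have phiL r : 0 < r -> (\int[leb]_s (phi (expR (- s) * r))%:E =
    \int[leb]_s (phi (expR (- s)))%:E)%E.
  move=> r0.
  rewrite -(@lebesgue_integral_affine R 1 (- ln r) (fun s => (phi (expR (- s)))%:E))//.
  - apply: eq_integral => s _; rewrite mul1e mul1r opprD opprK expRD.
    by rewrite lnK.
  - by move=> s; rewrite lee_fin.
  - apply/measurable_EFinP; apply: (measurableT_comp mphi).
    by apply: (measurableT_comp mexp).
transitivity (\int[P]_x \int[leb]_s f1 (x, s))%E.
  apply: eq_integral => x _; rewrite /f1/=.
  under eq_integral do rewrite EFinM.
  rewrite ge0_integralZl//; last 3 first.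
  - apply/measurable_EFinP; apply: (measurableT_comp mpsi).
    exact: measurable_funD.
  - by move=> s _; rewrite lee_fin.
  - by rewrite lee_fin !mulr_ge0 ?expR_ge0.
  by rewrite psi1 mule1 mulrAC.
rewrite fubini_tonelli//.
transitivity (\int[leb]_s \int[P]_x f2 (x, s))%E; last first.
  rewrite -fubini_tonelli// -ge0_integralZr//; last 3 first.
  - apply/measurable_EFinP.
    apply: (measurableT_comp (f := fun t => G t * psi (ln (v t)) * expR (tdot b t)) _ mV).
    apply: measurable_funM => //; apply: measurable_funM => //.
    exact: measurableT_comp.
  - by move=> x _; rewrite lee_fin !mulr_ge0 ?expR_ge0.
  - by apply: integral_ge0 => s _; rewrite lee_fin.
  apply: eq_integral => x _; rewrite /f2/=.
  have [G0x|Gx] := eqVneq (G (vec X x)) 0.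
    rewrite G0x !mul0r mul0e; apply: integral0_eq => s _.
    by rewrite !mul0r.
  under eq_integral do rewrite EFinM.
  rewrite ge0_integralZl//; last 3 first.
  - apply/measurable_EFinP; apply: (measurableT_comp mphi).
    apply: measurable_funM => //.
    by apply: (measurableT_comp mexp).
  - by move=> s _; rewrite lee_fin.
  - by rewrite lee_fin !mulr_ge0 ?expR_ge0.
  by rewrite phiL ?Gu// [in RHS]mulrAC.
apply: eq_integral => s _.
pose H t := G t * phi (expR (- s) * u t) * psi (ln (v t)).
have H0 t : 0 <= H t by rewrite !mulr_ge0.
have mH : measurable_fun [set: n.-tuple R] H.
  apply: measurable_funM; first apply: measurable_funM => //.
    by apply: (measurableT_comp mphi); exact: measurable_funM.
  exact: measurableT_comp.
transitivity (\int[P]_x ((expR s `^ A)%:E *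
    (H (tscale (expR s) (vec X x)) * expR (tdot b (vec X x)))%:E))%E.
  apply: eq_integral => x _; rewrite /f1 -EFinM; congr EFin.
  rewrite /H Gk ?expR_gt0// uk ?expR_gt0// vk ?expR_gt0//=.
  have [->|Gx] := eqVneq (G (vec X x)) 0; first by rewrite !(mulr0, mul0r).
  have -> : expR (- s) * (expR s * u (vec X x)) = u (vec X x).
    by rewrite mulrA -expRD addNr expR0 mul1r.
  rewrite lnM ?posrE ?expR_gt0 ?Gv// expRK.
  rewrite powRN; field.
  by rewrite gt_eqF// powR_gt0 ?expR_gt0.
rewrite ge0_integralZl//; last 2 first.
- apply/measurable_EFinP; apply: measurable_funM; last exact: (measurableT_comp mE mV).
  apply: (measurableT_comp mH).
  apply/measurable_fun_tnthP => i.
  rewrite (_ : _ \o _ = fun x => expR s * X i x); first exact: measurable_funM.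
  by apply/funext => x; rewrite /= !tnth_mktuple.
- by move=> x _; rewrite lee_fin mulr_ge0 ?expR_ge0.
rewrite (gamma_vector_weight_scale P X a b)// ?expR_gt0// muleA -EFinM.
rewrite -/A -powRD ?subrr ?powRr0 ?mul1e; last by rewrite lt0r_neq0 ?expR_gt0 ?implybT.
apply: eq_integral => x _; rewrite /f2/= /H; congr EFin; ring.
Qed.

(** The right-hand side of [gamma_vector_radial_average] does not contain [u]; it is applied to the
    pairs [u], [v] and [v], [v]. *)
Lemma gamma_vector_homogeneous_swap {d : measure_display} {T : measurableType d}
    {R : realType} (P : probability T R) {n : nat} (X : 'I_n -> T -> R)
    (a b : 'I_n -> R) (G u v : n.-tuple R -> R) (phi : R -> R) :
  (forall i, 0 < b i) -> gamma_vector P X a b ->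
  (forall t, 0 <= G t) -> (forall r, 0 <= phi r) ->
  measurable_fun [set: n.-tuple R] G -> measurable_fun [set: R] phi ->
  measurable_fun [set: n.-tuple R] u -> measurable_fun [set: n.-tuple R] v ->
  (forall k t, 0 < k -> G (tscale k t) = k `^ (- \sum_(i < n) a i) * G t) ->
  (forall k t, 0 < k -> u (tscale k t) = k * u t) ->
  (forall k t, 0 < k -> v (tscale k t) = k * v t) ->
  (forall t, G t != 0 -> 0 < u t) -> (forall t, G t != 0 -> 0 < v t) ->
  (\int[P]_x (G (vec X x) * phi (u (vec X x)) * expR (tdot b (vec X x)))%:E =
   \int[P]_x (G (vec X x) * phi (v (vec X x)) * expR (tdot b (vec X x)))%:E)%E.
Proof.
move=> b0 GX G0 phi0 mG mphi mu mv Gk uk vk Gu Gv.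
rewrite (gamma_vector_radial_average P X a b G u v phi)//.
by rewrite [RHS](gamma_vector_radial_average P X a b G v v phi).
Qed.

(** * The closure map on tuples, and the density between closure laws *)

Definition tclosure {R : realType} {n : nat} (t : n.-tuple R) : n.-tuple R :=
  [tuple tnth t i / \sum_(j < n) tnth t j | i < n].

Lemma measurable_tclosure {R : realType} {n : nat} :
  measurable_fun [set: n.-tuple R] (@tclosure R n).
Proof.
apply/measurable_fun_tnthP => i.
rewrite (_ : _ \o _ = fun t => tnth t i / \sum_(j < n) tnth t j); last first.
  by apply/funext => t; rewrite /= tnth_mktuple.
apply: measurable_funM; first exact: measurable_tnth.
apply: measurableT_comp; first exact: measurable_inv.
by apply: measurable_sum => j; exact: measurable_tnth.
Qed.

Lemma tclosure_scale {R : realType} {n : nat} (k : R) (t : n.-tuple R) :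
  k != 0 -> tclosure (tscale k t) = tclosure t.
Proof.
move=> k0; apply: eq_from_tnth => i; rewrite !tnth_mktuple.
under eq_bigr do rewrite tnth_mktuple.
by rewrite -mulr_sumr invfM mulrACA divff// mul1r.
Qed.

Lemma tdot_closure {R : realType} {n : nat} (b : 'I_n -> R) (t : n.-tuple R) :
  tdot b (tclosure t) = tdot b t / \sum_(j < n) tnth t j.
Proof.
by rewrite /tdot mulr_suml; apply: eq_bigr => i _; rewrite tnth_mktuple mulrA.
Qed.

Lemma tdot_gt0 {R : realType} {n : nat} (b : 'I_n -> R) (t : n.-tuple R) :
  (0 < n)%N -> (forall i, 0 < b i) -> (forall i, 0 < tnth t i) -> 0 < tdot b t.
Proof.
move=> n0 b0 t0; rewrite /tdot (bigD1 (Ordinal n0))//= ltr_pwDl ?mulr_gt0//.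
by apply: sumr_ge0 => i _; rewrite ltW ?mulr_gt0.
Qed.

(** A ratio of linear forms has degree 0, so the total by which the closure divides cancels. *)
Lemma tdot_closure_ratio {R : realType} {n : nat} (b c : 'I_n -> R)
    (t : n.-tuple R) : (0 < n)%N -> (forall i, 0 < tnth t i) ->
  tdot b (tclosure t) / tdot c (tclosure t) = tdot b t / tdot c t.
Proof.
move=> n0 t0.
have s0 : \sum_(j < n) tnth t j != 0.
  rewrite gt_eqF//.
  have := tdot_gt0 (fun=> 1) t n0 (fun=> ltr01) t0.
  by rewrite /tdot; under eq_bigr do rewrite mul1r.
by rewrite !tdot_closure invf_div mulrA divfK.
Qed.

(** Density of the closure law with rates [c] with respect to the one with rates [b]. *)
Definition closure_density {R : realType} {n : nat} (a b c : 'I_n -> R)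
    (t : n.-tuple R) : R :=
  (\prod_(i < n) (c i / b i) `^ a i) *
  (tdot b t / tdot c t) `^ (\sum_(i < n) a i).

Lemma closure_density_ge0 {R : realType} {n : nat} (a b c : 'I_n -> R)
    (t : n.-tuple R) : 0 <= closure_density a b c t.
Proof. by rewrite mulr_ge0 ?powR_ge0// prodr_ge0// => i _; exact: powR_ge0. Qed.

Lemma measurable_tdot_ratio {R : realType} {n : nat} (b c : 'I_n -> R) :
  measurable_fun [set: n.-tuple R] (fun t => tdot b t / tdot c t).
Proof.
apply: measurable_funM; first exact: measurable_tdot.
apply: measurableT_comp; first exact: measurable_inv.
exact: measurable_tdot.
Qed.

Lemma measurable_closure_density {R : realType} {n : nat} (a b c : 'I_n -> R) :
  measurable_fun [set: n.-tuple R] (closure_density a b c).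
Proof.
apply: measurable_funM => //.
exact: (measurableT_comp (measurable_powR _) (measurable_tdot_ratio b c)).
Qed.

Lemma integral_tclosure_change {d d' : measure_display} {T : measurableType d}
    {T' : measurableType d'} {R : realType} (P : probability T R)
    (Q : probability T' R) {n : nat} (X : 'I_n -> T -> R) (Y : 'I_n -> T' -> R)
    (a b c : 'I_n -> R) (f : n.-tuple R -> R) :
  (0 < n)%N -> (forall i, 0 < b i) -> (forall i, 0 < c i) ->
  gamma_vector P X a b -> gamma_vector Q Y a c ->
  (forall t, 0 <= f t) -> measurable_fun [set: n.-tuple R] f ->
  (\int[Q]_y (f (tclosure (vec Y y)))%:E =
   \int[P]_x (f (tclosure (vec X x)) *
              closure_density a b c (tclosure (vec X x)))%:E)%E.
Proof.
move=> n0 b0 c0 GX GY f0 mf.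
have [mX _ _] := GX; have [mY _ _] := GY.
have mVX := measurable_vec X mX; have mVY := measurable_vec Y mY.
set A := \sum_(i < n) a i.
set C := \prod_(i < n) (c i / b i) `^ a i.
have C0 : 0 <= C by rewrite prodr_ge0// => i _; exact: powR_ge0.
(* The swap of linear forms requires both to be positive wherever [G] is nonzero; the indicator of
   the positive orthant in [G] ensures this. *)
pose pos : set (n.-tuple R) := [set t | forall i, 0 < tnth t i].
have mpos : measurable pos.
  rewrite (_ : pos = \bigcap_(i in [set: 'I_n])
      ((@tnth n R ^~ i) @^-1` [set r | 0 < r])); last first.
    by apply/seteqP; split=> [t ti i _|t ti i]; exact: ti.
  apply: fin_bigcap_measurable => [|i _]; first exact: finite_finset.
  rewrite -[X in measurable X]setTI; apply: measurable_tnth => //.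
  rewrite (_ : [set r | _] = `]0, +oo[%classic); first exact: measurable_itv.
  by apply/seteqP; split=> r /=; rewrite in_itv/= andbT.
have pos_scale k t : 0 < k -> (tscale k t \in pos) = (t \in pos).
  move=> k0; apply/idP/idP; rewrite !inE => kt i; have := kt i;
    by rewrite tnth_mktuple pmulr_rgt0.
pose G t := C * (\1_pos t * f (tclosure t) * tdot c t `^ (- A)).
pose phi r := r `^ A * expR (- r).
have mfc : measurable_fun [set: n.-tuple R] (fun t => f (tclosure t)).
  exact: (measurableT_comp mf measurable_tclosure).
have mpf : measurable_fun [set: n.-tuple R] (fun t => \1_pos t * f (tclosure t)).
  exact: measurable_funM.
have mG : measurable_fun [set: n.-tuple R] G.
  apply: measurable_funM => //; apply: measurable_funM => //.
  exact: (measurableT_comp (measurable_powR _) (measurable_tdot c)).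
have mphi : measurable_fun [set: R] phi.
  apply: measurable_funM; first exact: measurable_powR.
  by apply: (measurableT_comp (@measurable_expR R)).
have G0 t : 0 <= G t by rewrite !mulr_ge0 ?powR_ge0.
have phi0 r : 0 <= phi r by rewrite mulr_ge0 ?powR_ge0 ?expR_ge0.
have Gpos t : G t != 0 -> pos t.
  move=> Gt; apply: contrapT => tpos; move/eqP: Gt; apply.
  by rewrite /G indicE memNset// !mul0r mulr0.
have Gk k t : 0 < k -> G (tscale k t) = k `^ (- A) * G t.
  move=> k0; rewrite /G !indicE pos_scale// tclosure_scale ?gt_eqF//.
  have [tpos|_] := boolP (t \in pos); last by rewrite !mul0r !mulr0.
  have ct : 0 < tdot c t by apply: tdot_gt0 => // i; move: tpos; rewrite inE; exact.
  by rewrite tdot_scale powRM ?ltW//; ring.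
transitivity (\int[Q]_y (\1_pos (vec Y y) * f (tclosure (vec Y y)))%:E)%E.
  apply: ge0_ae_eq_integral => //.
  - exact/measurable_EFinP/(measurableT_comp mfc).
  - exact/measurable_EFinP/(measurableT_comp mpf).
  - by move=> y _; rewrite lee_fin.
  - by move=> y _; rewrite lee_fin mulr_ge0.
  - apply: filterS (gamma_vector_gt0 Q Y a c GY) => y Y0 _.
    rewrite indicE mem_set ?mul1r// => i; rewrite tnth_mktuple; exact: Y0.
rewrite (gamma_vector_change_of_rate P Q X Y a b c
  (fun t => (\1_pos t * f (tclosure t))%:E))//; last 2 first.
- by move=> t; rewrite lee_fin mulr_ge0.
- exact/measurable_EFinP.
transitivity (\int[P]_x (G (vec X x) * phi (tdot c (vec X x)) *
    expR (tdot b (vec X x)))%:E)%E.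
  apply: eq_integral => x _; rewrite -EFinM; congr EFin; rewrite /G /phi.
  rewrite -/C indicE; have [xpos|_] := boolP (_ \in pos); last first.
    by rewrite !mul0r !mulr0 !mul0r.
  have cx : 0 < tdot c (vec X x).
    by apply: tdot_gt0 => // i; move: xpos; rewrite inE; exact.
  have -> : - (\sum_(i < n) (c i - b i) * X i x) =
      - tdot c (vec X x) + tdot b (vec X x).
    rewrite !tdot_vec -sumrN -sumrN -big_split/=; apply: eq_bigr => i _; ring.
  rewrite expRD powRN; field.
  by rewrite gt_eqF// powR_gt0.
(* After the swap the exponential in [phi (tdot b _)] cancels the weight, and the powers combine
   into that of the ratio [tdot b / tdot c]. *)
rewrite (gamma_vector_homogeneous_swap P X a b G (tdot c) (tdot b) phi)//; last 6 first.
- exact: measurable_tdot.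
- exact: measurable_tdot.
- by move=> k t _; exact: tdot_scale.
- by move=> k t _; exact: tdot_scale.
- by move=> t /Gpos; exact: tdot_gt0.
- by move=> t /Gpos; exact: tdot_gt0.
apply: ge0_ae_eq_integral => //.
- apply/measurable_EFinP.
  apply: (measurableT_comp (f := fun t => G t * phi (tdot b t) * expR (tdot b t)) _ mVX).
  apply: measurable_funM; first apply: measurable_funM => //.
    exact: (measurableT_comp mphi (measurable_tdot b)).
  exact: (measurableT_comp (@measurable_expR R) (measurable_tdot b)).
- apply/measurable_EFinP; apply: (measurableT_comp
    (f := fun t => f (tclosure t) * closure_density a b c (tclosure t)) _ mVX).
  apply: measurable_funM => //.
  exact: (measurableT_comp (measurable_closure_density a b c) measurable_tclosure).
- by move=> x _; rewrite lee_fin mulr_ge0 ?expR_ge0//; exact: mulr_ge0.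
- by move=> x _; rewrite lee_fin mulr_ge0 ?closure_density_ge0.
apply: filterS (gamma_vector_gt0 P X a b GX) => x X0 _.
have xpos i : 0 < tnth (vec X x) i by rewrite tnth_mktuple.
have cx := tdot_gt0 c _ n0 c0 xpos; have bx := tdot_gt0 b _ n0 b0 xpos.
rewrite /G /phi indicE mem_set// /closure_density tdot_closure_ratio// -/C -/A.
rewrite powRM ?invr_ge0 ?ltW// -powR_inv1 ?ltW// -powRrM mulN1r mul1r.
congr EFin; rewrite expRN; field.
by rewrite gt_eqF ?expR_gt0.
Qed.

(** * Means of the normalised components, by a variational inequality *)

Lemma powR_bernoulli {R : realType} (s w : R) : 0 <= s -> 0 <= w ->
  1 - s * w <= (1 + w) `^ (- s).
Proof.
move=> s0 w0; have w1 : 0 < 1 + w by rewrite ltr_pwDl.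
(* The chain is [1 - s * w <= 1 - s * ln (1 + w) <= expR (- s * ln (1 + w))]. *)
rewrite /powR gt_eqF//; apply: le_trans (expR_ge1Dx _).
rewrite lerD2l mulNr lerN2 ler_wpM2l// le_ln1Dx//.
by apply: lt_le_trans w0; rewrite oppr_lt0.
Qed.

(* Letting [v] tend to 0 yields the comparison of derivatives at 0. *)
Lemma le_of_powR_le_affine {R : realType} (alpha K : R) : 0 <= alpha -> 0 <= K ->
  (forall v, 0 < v -> (1 + v) `^ alpha <= 1 + (1 + v) `^ alpha * (K * v)) ->
  alpha <= K.
Proof.
move=> al0 K0 H; apply/ler_addgt0Pr => e e0.
(* For [v <= 1], the product [(1 + v) * (1 + alpha * v)] exceeds 1 by at most [(1 + 2 * alpha) * v];
   this [v] keeps [K] times the excess below [e]. The added 1 keeps the denominator positive when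
   [K = 0]. *)
have D0 : 0 < K * (1 + 2 * alpha) + 1 by nra.
pose v := Num.min 1 (e / (K * (1 + 2 * alpha) + 1)).
have v0 : 0 < v by rewrite lt_min ltr01 divr_gt0.
have v1 : v <= 1 by rewrite ge_min lexx.
have ve : (K * (1 + 2 * alpha) + 1) * v <= e.
  by rewrite mulrC -ler_pdivlMr// ge_min lexx orbT.
have w1 : 0 < 1 + v by lra.
set z := alpha * ln (1 + v).
have lnv : ln (1 + v) <= v by apply: le_ln1Dx; lra.
have lnv' : v <= (1 + v) * ln (1 + v).
  have : ln (1 + - (v / (1 + v))) <= - (v / (1 + v)).
    by apply: le_ln1Dx; rewrite ltrN2 ltr_pdivrMr//; lra.
  have -> : 1 + - (v / (1 + v)) = (1 + v)^-1 by field; rewrite gt_eqF.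
  by rewrite lnV// lerN2 ler_pdivrMr// mulrC.
have z0 : 0 <= z by rewrite mulr_ge0// ln_ge0; lra.
have zv : z <= alpha * v by rewrite ler_wpM2l.
have vz : alpha * v <= (1 + v) * z by rewrite mulrCA ler_wpM2l.
have Cz : 1 + z <= (1 + v) `^ alpha by rewrite /powR gt_eqF// expR_ge1Dx.
have Hv := H _ v0; set C := (1 + v) `^ alpha in Cz Hv.
have Kv0 : 0 <= K * v by rewrite mulr_ge0// ltW.
(* When [K * v < 1], the hypothesis reads [C * (1 - K * v) <= 1], and [1 + z <= C]; otherwise the
   bound is immediate. *)
have zK : z <= (1 + z) * (K * v).
  have [Kv1|Kv1] := leP 1 (K * v); first by nra.
  have : (1 + z) * (1 - K * v) <= C * (1 - K * v).
    by rewrite ler_wpM2r//; lra.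
  by nra.
have step : alpha * v <= (1 + v) * (1 + alpha * v) * K * v.
  apply: le_trans vz _; rewrite -!mulrA ler_wpM2l ?(ltW w1)//.
  by apply: le_trans zK _; rewrite ler_wpM2r//; lra.
have : alpha <= (1 + v) * (1 + alpha * v) * K by rewrite -(ler_pM2r v0).
have : alpha * v * v <= alpha * v by rewrite -[leRHS]mulr1 ler_wpM2l// mulr_ge0// ltW.
move=> avv Hal; apply: le_trans Hal _.
have : K * (v + alpha * v + alpha * v * v) <= K * ((1 + 2 * alpha) * v).
  by rewrite ler_wpM2l//; lra.
lra.
Qed.

(* The absolute value only matters on a null set: it makes the integrand
   nonnegative everywhere.  The bound comes from the total mass of the closure
   density of [X] with its [i]-th component divided by [1 + v]. *)
Lemma gamma_vector_mean_ge {d : measure_display} {T : measurableType d}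
    {R : realType} (P : probability T R) {n : nat} (X : 'I_n -> T -> R)
    (a b : 'I_n -> R) (i : 'I_n) (m : R) :
  (forall i, 0 < a i) -> (forall i, 0 < b i) -> gamma_vector P X a b ->
  (\int[P]_x (`| b i * X i x / tdot b (vec X x) |)%:E)%E = m%:E ->
  a i <= (\sum_(j < n) a j) * m.
Proof.
move=> a0 b0 GX mE.
have n0 : (0 < n)%N by exact: leq_ltn_trans (leq0n i) (ltn_ord i).
have [mX _ _] := GX; have mV := measurable_vec X mX.
set A := \sum_(j < n) a j.
have A0 : 0 <= A by apply: sumr_ge0 => j _; exact: ltW.
pose u x := `| b i * X i x / tdot b (vec X x) |.
have mu : measurable_fun [set: T] u.
  apply: measurableT_comp => //; apply: measurable_funM.
    exact: measurable_funM.
  apply: measurableT_comp; first exact: measurable_inv.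
  exact: (measurableT_comp (measurable_tdot b) mV).
have m0 : 0 <= m.
  by rewrite -lee_fin -mE; apply: integral_ge0 => x _; rewrite lee_fin.
apply: le_of_powR_le_affine => [||v v0]; [exact: ltW|exact: mulr_ge0|].
have v1 : 0 < 1 + v by lra.
pose k (j : 'I_n) : R := if j == i then (1 + v)^-1 else 1.
have k0 j : 0 < k j by rewrite /k; case: ifP; rewrite ?invr_gt0.
pose c j := b j / k j.
have c0 j : 0 < c j by rewrite divr_gt0.
have GkX := gamma_vector_scale P X a b k b0 k0 GX.
set C := (1 + v) `^ a i.
have C0 : 0 <= C by exact: powR_ge0.
have CE : \prod_(j < n) (c j / b j) `^ a j = C.
  rewrite (bigD1 i)//= [X in _ * X]big1 ?mulr1.
    rewrite /c /k eqxx invrK; congr (_ `^ _); field.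
    by rewrite gt_eqF.
  move=> j /negbTE ji; rewrite /c /k ji divr1 divff ?gt_eqF//.
  by rewrite powR1.
have hE : (\int[P]_x (closure_density a b c (tclosure (vec X x)))%:E = 1)%E.
  have kh := integral_tclosure_change P P X _ a b c (fun=> 1) n0 b0 c0 GX GkX
    (fun=> ler01) (measurable_cst _).
  transitivity (\int[P]_x 1%:E)%E.
    by rewrite kh; apply: eq_integral => x _; rewrite mul1r.
  by rewrite integral_cst// mul1e; exact: probability_setT.
have mh : measurable_fun [set: T] (fun x => closure_density a b c (tclosure (vec X x))).
  exact: (measurableT_comp (measurableT_comp (measurable_closure_density a b c)
    measurable_tclosure) mV).
have -> : C * (A * m * v) = C * (A * v) * m by ring.
rewrite -lee_fin EFinD EFinM -hE -mE -ge0_integralZl//; last 2 first.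
- exact/measurable_EFinP.
- by rewrite lee_fin !mulr_ge0// ltW.
rewrite -ge0_integralD//; last 4 first.
- by move=> x _; rewrite lee_fin closure_density_ge0.
- exact/measurable_EFinP.
- by move=> x _; rewrite lee_fin !mulr_ge0// ltW.
- by apply/measurable_EFinP; exact: measurable_funM.
have -> : C%:E = (\int[P]_x C%:E)%E.
  by rewrite integral_cst// [X in (_ * X)%E](_ : _ = 1%E) ?mule1//; exact: probability_setT.
apply: ae_ge0_le_integral => //.
- by move=> x _; rewrite adde_ge0// lee_fin ?closure_density_ge0// !mulr_ge0// ltW.
- apply: emeasurable_funD; first exact/measurable_EFinP.
  by apply/measurable_EFinP; exact: measurable_funM.
apply: filterS (gamma_vector_gt0 P X a b GX) => x X0 _.
have xpos j : 0 < tnth (vec X x) j by rewrite tnth_mktuple.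
have cx := tdot_gt0 c _ n0 c0 xpos; have bx := tdot_gt0 b _ n0 b0 xpos.
rewrite -EFinM -EFinD lee_fin /closure_density tdot_closure_ratio// CE.
have u0 : 0 <= b i * X i x / tdot b (vec X x) by rewrite divr_ge0 ?mulr_ge0 ?ltW.
rewrite ger0_norm//; set w := b i * X i x / _ in u0 *.
(* Only the [i]-th rate changes, from [b i] to [(1 + v) * b i], so [tdot c] exceeds [tdot b] by
   [v * (b i * X i x)]. *)
have -> : tdot b (vec X x) / tdot c (vec X x) = (1 + v * w)^-1.
  rewrite -[LHS]invf_div; congr (_^-1).
  have -> : tdot c (vec X x) = tdot b (vec X x) + v * (b i * X i x).
    rewrite /tdot (bigD1 i)//= [in RHS](bigD1 i)//= !tnth_mktuple.
    rewrite (eq_bigr (fun j => b j * tnth (vec X x) j)); last first.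
      by move=> j /negbTE ji; rewrite /c /k ji divr1.
    by rewrite /c /k eqxx invrK; ring.
  by rewrite /w; field; rewrite gt_eqF.
have vw0 : 0 <= v * w by rewrite mulr_ge0// ltW.
(* Multiplied by [C], this bounds [C] by the density plus [C * (A * v) * w]; the density has
   integral 1 and [w] has mean [m]. *)
have := @powR_bernoulli _ A (v * w) A0 vw0.
rewrite -powR_inv1 ?addr_ge0// -powRrM mulN1r => B.
rewrite -mulrA -mulrDr ler_peMr//.
by rewrite -/A; lra.
Qed.

(* The lower bounds are equalities because both sides sum to 1 over [i]. *)
Lemma gamma_vector_mean {d : measure_display} {T : measurableType d}
    {R : realType} (P : probability T R) {n : nat} (X : 'I_n -> T -> R)
    (a b : 'I_n -> R) (i : 'I_n) :
  (forall i, 0 < a i) -> (forall i, 0 < b i) -> gamma_vector P X a b ->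
  (\int[P]_x (`| b i * X i x / tdot b (vec X x) |)%:E)%E =
  (a i / \sum_(j < n) a j)%:E.
Proof.
move=> a0 b0 GX.
have n0 : (0 < n)%N by exact: leq_ltn_trans (leq0n i) (ltn_ord i).
have [mX _ _] := GX; have mV := measurable_vec X mX.
set A := \sum_(j < n) a j.
have A0 : 0 < A.
  rewrite /A (bigD1 i)//= ltr_pwDl//; apply: sumr_ge0 => j _; exact: ltW.
pose u j x := `| b j * X j x / tdot b (vec X x) |.
have mu j : measurable_fun [set: T] (fun x => (u j x)%:E).
  apply/measurable_EFinP; apply: measurableT_comp => //; apply: measurable_funM.
    exact: measurable_funM.
  apply: measurableT_comp; first exact: measurable_inv.
  exact: (measurableT_comp (measurable_tdot b) mV).
have u0 j x : (0 <= (u j x)%:E)%E by rewrite lee_fin normr_ge0.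
have sumu : (\sum_(j < n) \int[P]_x (u j x)%:E = 1)%E.
  rewrite -ge0_integral_sum//; transitivity (\int[P]_x (cst 1 x))%E; last first.
    by rewrite integral_cst// mul1e; exact: probability_setT.
  apply: ge0_ae_eq_integral => //.
  - exact: emeasurable_sum.
  - by move=> x _; exact: sume_ge0.
  apply: filterS (gamma_vector_gt0 P X a b GX) => x X0 _.
  have xpos j : 0 < tnth (vec X x) j by rewrite tnth_mktuple.
  have bx := tdot_gt0 b _ n0 b0 xpos.
  rewrite sumEFin /=; congr EFin; rewrite -[RHS](@divff _ (tdot b (vec X x))).
    rewrite [in X in _ = X / _]tdot_vec mulr_suml; apply: eq_bigr => j _.
    by rewrite /u ger0_norm// divr_ge0 ?mulr_ge0 ?ltW.
  by rewrite gt_eqF.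
(* Each mean is one nonnegative term of a sum equal to 1. *)
have ufin j : (\int[P]_x (u j x)%:E)%E \is a fin_num.
  rewrite ge0_fin_numE; last by apply: integral_ge0 => x _.
  apply: (@le_lt_trans _ _ 1%E); last exact: ltry.
  rewrite -sumu (bigD1 j)//= leeDl// sume_ge0// => l _.
  by apply: integral_ge0 => x _.
pose m j := fine (\int[P]_x (u j x)%:E)%E.
have mE j : (\int[P]_x (u j x)%:E)%E = (m j)%:E by rewrite fineK.
have sumA : \sum_(j < n) (m j - a j / A) = 0.
  rewrite big_split/= sumrN -mulr_suml -/A divff ?gt_eqF//.
  have : (\sum_(j < n) m j)%:E = 1%E :> \bar R.
    by rewrite -sumEFin -sumu; apply: eq_bigr => j _; rewrite mE.
  by move=> [->]; rewrite subrr.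
have : forall j, true -> m j - a j / A = 0.
  apply: psumr_eq0P sumA => j _.
  rewrite subr_ge0 ler_pdivrMr// mulrC.
  exact: (gamma_vector_mean_ge P X a b j _ a0 b0 GX (mE j)).
by move=> /(_ i isT)/eqP; rewrite subr_eq0 => /eqP <-; exact: mE.
Qed.

(** * Renyi divergence from a density, and the moment that it requires *)

Lemma closure_funE {d : measure_display} {T : measurableType d} {R : realType}
    (P : probability T R) {n : nat} (X : 'I_n -> {RV P >-> R}) (w : T) :
  closure_fun X w = tclosure (vec (fun i => X i : T -> R) w).
Proof.
apply: eq_from_tnth => i; rewrite !tnth_mktuple.
by under [in RHS]eq_bigr do rewrite tnth_mktuple.
Qed.

Lemma Radon_Nikodym_ae_eq {d : measure_display} {T : measurableType d}
    {R : realType} (mu nu : probability T R) (h : T -> \bar R) :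
  measurable_fun [set: T] h -> nu `<< mu ->
  (forall A, measurable A -> nu A = \int[mu]_(x in A) h x)%E ->
  ae_eq mu [set: T] (Radon_Nikodym (charge_of_finite_measure nu) mu) h.
Proof.
move=> mh numu nuE; apply: integral_ae_eq => //.
- exact: Radon_Nikodym_integrable.
- by move=> A _ mA; rewrite -Radon_Nikodym_integral// -nuE.
Qed.

Lemma ln_prod_powR {R : realType} {n : nat} (x y : 'I_n -> R) :
  (forall i, 0 < x i) ->
  ln (\prod_(i < n) x i `^ y i) = \sum_(i < n) y i * ln (x i).
Proof.
move=> x0; rewrite -[RHS]expRK expR_sum; congr ln; apply: eq_bigr => i _.
by rewrite /powR gt_eqF.
Qed.

(** Any explicit density gives absolute continuity and agrees almost everywhere with the
    Radon-Nikodym derivative; finiteness of the moment [r] selects the real branch of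
    [renyi_div]. *)
Lemma renyi_div_density {d : measure_display} {T : measurableType d}
    {R : realType} (s : R) (mu nu : probability T R) (h : T -> R) (r : R) :
  (forall x, 0 <= h x) -> measurable_fun [set: T] h ->
  (forall A, measurable A -> nu A = \int[mu]_(x in A) (h x)%:E)%E ->
  (\int[mu]_x (h x `^ s)%:E = r%:E)%E ->
  renyi_div s nu mu = ((s - 1)^-1 * ln r)%:E.
Proof.
move=> h0 mh nuE hr.
have numu : nu `<< mu.
  apply/null_content_dominatesP => A mA muA; rewrite nuE//.
  apply: null_set_integral => //.
  exact/measurable_EFinP/measurable_funTS.
have mhE : measurable_fun [set: T] (EFin \o h) by exact/measurable_EFinP.
have RNh := Radon_Nikodym_ae_eq mu nu _ mhE numu nuE.
rewrite /renyi_div; case: pselect => [numu'|//].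
have mRN : measurable_fun [set: T]
    (Radon_Nikodym (charge_of_finite_measure nu) mu).
  by apply: (measurable_int mu); exact: Radon_Nikodym_integrable.
rewrite (_ : (\int[mu]_x _)%E = r%:E)// -hr.
apply: ge0_ae_eq_integral => //.
- apply/measurable_EFinP; apply: (measurableT_comp (measurable_powR _)).
  exact: (measurableT_comp (fine_measurable _) mRN).
- by apply/measurable_EFinP; apply: (measurableT_comp (measurable_powR _)).
- by move=> x _; rewrite lee_fin powR_ge0.
- by move=> x _; rewrite lee_fin powR_ge0.
by apply: filterS RNh => x /= /(_ I) ->.
Qed.

(** The ratio is the combination with coefficients [b j / c j] of the components
    [c j * Y j / tdot c], whose means are known. The absolute values have the same purpose as in
    [gamma_vector_mean_ge]. *)
Lemma expectation_tdot_ratio {d : measure_display} {T : measurableType d}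
    {R : realType} (Q : probability T R) {n : nat} (Y : 'I_n -> T -> R)
    (a b c : 'I_n -> R) :
  (0 < n)%N -> (forall i, 0 < a i) -> (forall i, 0 < b i) -> (forall i, 0 < c i) ->
  gamma_vector Q Y a c ->
  (\int[Q]_y (`| tdot b (vec Y y) / tdot c (vec Y y) |)%:E)%E =
  (\sum_(i < n) b i / c i * (a i / \sum_(j < n) a j))%:E.
Proof.
move=> n0 a0 b0 c0 GY; have [mY _ _] := GY; have mV := measurable_vec Y mY.
pose u j y := `| c j * Y j y / tdot c (vec Y y) |.
have mu j : measurable_fun [set: T] (fun x => (u j x)%:E).
  apply/measurable_EFinP; apply: measurableT_comp => //; apply: measurable_funM.
    exact: measurable_funM.
  apply: measurableT_comp; first exact: measurable_inv.
  exact: (measurableT_comp (measurable_tdot c) mV).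
have bc0 j : 0 <= b j / c j by rewrite divr_ge0 ?ltW.
transitivity (\int[Q]_y \sum_(j < n) ((b j / c j)%:E * (u j y)%:E))%E.
  apply: ge0_ae_eq_integral => //.
  - apply/measurable_EFinP; apply: measurableT_comp => //.
    exact: (measurableT_comp (measurable_tdot_ratio b c) mV).
  - by apply: emeasurable_sum => j; exact: measurable_funeM.
  - by move=> y _; apply: sume_ge0 => j _; rewrite mule_ge0 ?lee_fin ?normr_ge0.
  apply: filterS (gamma_vector_gt0 Q Y a c GY) => y Y0 _.
  have ypos j : 0 < tnth (vec Y y) j by rewrite tnth_mktuple.
  have cy := tdot_gt0 c _ n0 c0 ypos; have bY := tdot_gt0 b _ n0 b0 ypos.
  under [RHS]eq_bigr do rewrite -EFinM.
  rewrite sumEFin; congr EFin; rewrite ger0_norm ?divr_ge0 ?ltW//.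
  rewrite [in X in X / _]tdot_vec mulr_suml; apply: eq_bigr => j _.
  rewrite /u ger0_norm; last by rewrite divr_ge0 ?mulr_ge0 ?ltW.
  by field; rewrite !gt_eqF.
rewrite ge0_integral_sum//; last 2 first.
- by move=> j; exact: measurable_funeM.
- by move=> j y _; rewrite mule_ge0 ?lee_fin ?normr_ge0.
rewrite -sumEFin; apply: eq_bigr => j _.
rewrite ge0_integralZl//; last 2 first.
- by move=> y _; rewrite lee_fin normr_ge0.
- by rewrite lee_fin.
by rewrite (gamma_vector_mean Q Y a c j a0 c0 GY) -EFinM.
Qed.

(** Since the shapes sum to the inverse of [s], the power [s] turns the density into a multiple of
    the ratio itself, and [a i / A] becomes [s * a i]. *)
Lemma expectation_closure_density_powR {d : measure_display}
    {T : measurableType d} {R : realType} (Q : probability T R) {n : nat}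
    (Y : 'I_n -> T -> R) (a b c : 'I_n -> R) (s : R) :
  (0 < n)%N -> (forall i, 0 < a i) -> (forall i, 0 < b i) -> (forall i, 0 < c i) ->
  gamma_vector Q Y a c -> (\sum_(i < n) a i) * s = 1 ->
  (\int[Q]_y (closure_density a b c (tclosure (vec Y y)) `^ s)%:E)%E =
  ((\prod_(i < n) (c i / b i) `^ a i) `^ s *
   \sum_(i < n) b i / c i * (s * a i))%:E.
Proof.
move=> n0 a0 b0 c0 GY As; have [mY _ _] := GY; have mV := measurable_vec Y mY.
set C := \prod_(i < n) (c i / b i) `^ a i.
have C0 : 0 <= C by rewrite prodr_ge0// => i _; exact: powR_ge0.
have mr : measurable_fun [set: T] (fun y => `| tdot b (vec Y y) / tdot c (vec Y y) |).
  apply: measurableT_comp => //.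
  exact: (measurableT_comp (measurable_tdot_ratio b c) mV).
have A0 : \sum_(i < n) a i != 0.
  by apply: contra_eq_neq As => ->; rewrite mul0r eq_sym oner_eq0.
have sE : s = (\sum_(i < n) a i)^-1.
  by apply: (mulfI A0); rewrite As divff.
transitivity (\int[Q]_y ((C `^ s)%:E *
    (`| tdot b (vec Y y) / tdot c (vec Y y) |)%:E))%E.
  apply: ge0_ae_eq_integral => //.
  - apply/measurable_EFinP; apply: (measurableT_comp (measurable_powR _)).
    exact: (measurableT_comp (measurableT_comp (measurable_closure_density a b c)
      measurable_tclosure) mV).
  - exact/measurable_funeM/measurable_EFinP.
  - by move=> y _; rewrite lee_fin powR_ge0.
  - by move=> y _; rewrite mule_ge0// lee_fin powR_ge0.
  apply: filterS (gamma_vector_gt0 Q Y a c GY) => y Y0 _.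
  have ypos j : 0 < tnth (vec Y y) j by rewrite tnth_mktuple.
  have cy := tdot_gt0 c _ n0 c0 ypos; have bY := tdot_gt0 b _ n0 b0 ypos.
  rewrite -EFinM; congr EFin; rewrite /closure_density -/C.
  rewrite tdot_closure_ratio// powRM ?powR_ge0// -powRrM As.
  have r0 : 0 <= tdot b (vec Y y) / tdot c (vec Y y) by rewrite divr_ge0 ?ltW.
  by rewrite ger0_norm// powRr1.
rewrite ge0_integralZl//; last 2 first.
- exact/measurable_EFinP.
- by rewrite lee_fin powR_ge0.
rewrite (expectation_tdot_ratio Q Y a b c)// -EFinM; congr (_ * _)%:E.
by apply: eq_bigr => i _; rewrite sE [X in _ * X]mulrC.
Qed.

(* mu_{pi,x,sigma} = SD(pi/sigma, pi (.) x^{-1}) is the law of C[X] where the X_i are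
   independent, X_i ~ Gamma(shape pi_i/sigma, rate pi_i/x_i).  Here the law of C[X]
   (resp. C[Y]) is realised on arbitrary probability spaces (Tx, Px), (Ty, Py). *)
Theorem mainTheorem5 (R : realType) (n : nat) (pi x y : 'I_n -> R) (sigma : R)
    (dx : measure_display) (Tx : measurableType dx) (Px : probability Tx R)
    (X : 'I_n -> {RV Px >-> R})
    (dy : measure_display) (Ty : measurableType dy) (Py : probability Ty R)
    (Y : 'I_n -> {RV Py >-> R}) :
  (2 <= n)%N ->
  open_simplex pi -> 0 < sigma -> open_simplex x -> open_simplex y ->
  mutually_independent X ->
  (forall i, gamma_distributed (X i) (pi i / sigma) (pi i / x i)) ->
  mutually_independent Y ->
  (forall i, gamma_distributed (Y i) (pi i / sigma) (pi i / y i)) ->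
  renyi_div (1 + sigma)
    (distribution Py (closure_rv Y)) (distribution Px (closure_rv X))
  = (sigma^-1 * Gamma_div pi y x)%:E.
Proof.
move=> n2 [pi01 sum_pi] s0 [x01 _] [y01 _] iX lX iY lY.
have n0 : (0 < n)%N by exact: ltnW.
have pi0 i : 0 < pi i by case/andP: (pi01 i).
have x0 i : 0 < x i by case/andP: (x01 i).
have y0 i : 0 < y i by case/andP: (y01 i).
pose a i := pi i / sigma; pose b i := pi i / x i; pose c i := pi i / y i.
have a0 i : 0 < a i by rewrite divr_gt0.
have b0 i : 0 < b i by rewrite divr_gt0.
have c0 i : 0 < c i by rewrite divr_gt0.
pose X' i : Tx -> R := X i; pose Y' i : Ty -> R := Y i.
have GX : gamma_vector Px X' a b by split=> //; exact: lX.
have GY : gamma_vector Py Y' a c by split=> //; exact: lY.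
have [mX _ _] := GX; have mVX := measurable_vec X' mX.
have sum_a : (\sum_(i < n) a i) * sigma = 1.
  by rewrite -mulr_suml sum_pi mul1r mulVf// gt_eqF.
pose h := closure_density a b c.
have h0 t : 0 <= h t by exact: closure_density_ge0.
have mh : measurable_fun [set: n.-tuple R] h by exact: measurable_closure_density.
pose C := \prod_(i < n) (c i / b i) `^ a i.
pose S := \sum_(i < n) pi i * (y i / x i).
have C0 : 0 < C by rewrite prodr_gt0// => i _; rewrite powR_gt0// divr_gt0.
have S0 : 0 < S.
  rewrite /S (bigD1 (Ordinal n0))//= ltr_pwDl//; first by rewrite mulr_gt0 ?divr_gt0.
  by apply: sumr_ge0 => i _; rewrite ltW// mulr_gt0 ?divr_gt0.
rewrite (renyi_div_density _ _ _ h (C `^ sigma * S))//.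
- congr EFin; rewrite addrAC subrr add0r; congr (_ * _).
  rewrite lnM ?posrE ?powR_gt0// ln_powR ln_prod_powR; last first.
    by move=> i; rewrite divr_gt0.
  rewrite /Gamma_div -/S addrC; congr (_ + _).
  rewrite mulr_sumr -sumrN; apply: eq_bigr => i _.
  have -> : c i / b i = (y i / x i)^-1 by rewrite /c /b; field; rewrite !gt_eqF.
  rewrite lnV ?posrE ?divr_gt0// /a; field.
  by rewrite gt_eqF.
- move=> B mB.
  have mBI : measurable_fun [set: n.-tuple R] (\1_B : n.-tuple R -> R).
    exact: measurable_indic.
  transitivity (\int[distribution Py (closure_rv Y)]_t (\1_B t)%:E)%E.
    by rewrite integral_indic// setIT.
  rewrite ge0_integral_distribution//; last exact/measurable_EFinP.
  transitivity (\int[Py]_w (\1_B (tclosure (vec Y' w)))%:E)%E.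
    by apply: eq_integral => w _; rewrite /= closure_funE.
  rewrite (integral_tclosure_change Px Py X' Y' a b c)//.
  rewrite [RHS]integral_mkcond ge0_integral_distribution//; last 2 first.
  + apply/(measurable_restrictT _ mB)/measurable_EFinP; exact: measurable_funTS.
  + by move=> t; apply: erestrict_ge0 => u _; rewrite lee_fin.
  apply: eq_integral => w _; rewrite /= closure_funE patchE indicE.
  by case: (_ \in B); rewrite ?mul1r ?mul0r.
- rewrite ge0_integral_distribution//; last 2 first.
  + by apply/measurable_EFinP; apply: (measurableT_comp (measurable_powR _)).
  + by move=> t; rewrite lee_fin powR_ge0.
  (* One factor [h] is split off and absorbed in the passage from the law of [X] to that of [Y], so
     only the power [sigma] remains to be integrated. *)
  transitivity (\int[Px]_w (h (tclosure (vec X' w)) `^ sigma *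
      h (tclosure (vec X' w)))%:E)%E.
    apply: eq_integral => w _; rewrite /= closure_funE addrC.
    by rewrite powRD ?powRr1// gt_eqF// addr_gt0.
  rewrite -(integral_tclosure_change Px Py X' Y' a b c (fun t => h t `^ sigma))//.
  + rewrite (expectation_closure_density_powR Py Y' a b c sigma)//.
    congr (_ * _)%:E; apply: eq_bigr => i _; rewrite /a /b /c; field.
    by rewrite !gt_eqF.
  + by move=> t; exact: powR_ge0.
  + exact: (measurableT_comp (measurable_powR _) mh).
Qed.
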